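(* Let $1\le p_1,p_2,q_1,q_2<\infty$, and let $\mu_1,\mu_2,\nu_1,\nu_2$ be $\sigma$-finite Borel measures on $\mathbf R$. Let $a_1\le b_1$ be measurable functions of $x_1\in\mathbf R$, let $a_2\le b_2$ be measurable functions of $(x_1,x_2)\in\mathbf R^2$, and let $k_1(x_1,y_1)\ge0$ and $k_2(x_1,x_2,y_2)\ge0$ be measurable functions. Consider the two-dimensional Hardy--Steklov type operator $$\mathcal Kf(x_1,x_2)=\int_{a_1(x_1)}^{b_1(x_1)}\int_{a_2(x_1,x_2)}^{b_2(x_1,x_2)}f(y_1,y_2)\,k_1(x_1,y_1)\,k_2(x_1,x_2,y_2)\,dy_2\,dy_1$$ and the one-dimensional operators $$\mathcal K_1g(x_1)=\int_{a_1(x_1)}^{b_1(x_1)}g(y_1)k_1(x_1,y_1)\,dy_1,\qquad \mathcal K_2g(x_2)=\int_{a_2(x_1,x_2)}^{b_2(x_1,x_2)}g(y_2)k_2(x_1,x_2,y_2)\,dy_2,$$ where $\mathcal K_2$ depends on the parameter $x_1$. If $\mathcal K_1:L_{q_1}(\mathbf R,\nu_1)\to L_{p_1}(\mathbf R,\mu_1)$ is bounded and $\mathcal K_2:L_{q_2}(\mathbf R,\nu_2)\to L_{p_2}(\mathbf R,\mu_2)$ is bounded for $\mu_1$-a.e. $x_1$ with a bound independent of $x_1$, then $$\mathcal K:L_{q_1,q_2}(\mathbf R^2,\nu_1,\nu_2)\to L_{p_1,p_2}(\mathbf R^2,\mu_1,\mu_2)$$ is bounded.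
   Context: Functions are Borel measurable. The mixed norm Lebesgue space $L_{p_1,p_2}(\mathbf R^2,\mu_1,\mu_2)$ consists of the measurable functions $f$ on $\mathbf R^2$ with $$\|f\|=\bigg(\int_{\mathbf R}\bigg(\int_{\mathbf R}|f(x_1,x_2)|^{p_2}\,d\mu_2(x_2)\bigg)^{\frac{p_1}{p_2}}d\mu_1(x_1)\bigg)^{\frac1{p_1}}<\infty,$$ and $L_{q_1,q_2}(\mathbf R^2,\nu_1,\nu_2)$ is defined analogously. An operator is bounded between two such spaces if the norm of the image is at most a constant times the norm of the function, for every function in the source space. *)

(* Defs.v *)
From HB Require Import structures.
From mathcomp Require Import all_boot all_order all_algebra.
From mathcomp Require Import all_classical all_reals all_analysis.
From mathcomp Require Import measurable_realfun.

Set Implicit Arguments.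
Unset Strict Implicit.
Unset Printing Implicit Defensive.

Import Order.TTheory GRing.Theory Num.Theory.
Import numFieldNormedType.Exports.

Local Open Scope classical_set_scope.
Local Open Scope ring_scope.
Local Open Scope ereal_scope.

(* The norm of L_{p1,p2}(R^2, mu1, mu2): the inner integral, with exponent p2,
   is in the second variable. *)
Definition mixed_norm (R : realType)
    (mu1 mu2 : {sigma_finite_measure set (measurableTypeR R) -> \bar R})
    (p1 p2 : R) (f : R * R -> \bar R) : \bar R :=
  (\int[mu1]_x1 (\int[mu2]_x2 `|f (x1, x2)| `^ p2) `^ (p1 / p2)) `^ p1^-1.

(* Functions in the source space are real-valued. The operators below are total
   and return \bar R-valued functions, since an integral need not converge; by
   the convention +oo - oo = -oo an undefined integral has absolute value +oo,
   so that the bound on the norm forces convergence almost everywhere in the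
   target. *)
Definition bounded_by (R : realType) d (X : measurableType d) (C : R)
    (normS normT : (X -> \bar R) -> \bar R)
    (K : (X -> R) -> (X -> \bar R)) : Prop :=
  forall f : X -> R, measurable_fun setT f -> normS (EFin \o f) < +oo ->
    measurable_fun setT (K f) /\ normT (K f) <= C%:E * normS (EFin \o f).

Definition hardy_steklov1 (R : realType) (a1 b1 : R -> R) (k1 : R * R -> R)
    (g : R -> R) (x1 : R) : \bar R :=
  \int[lebesgue_measure]_(y1 in `[a1 x1, b1 x1]) (g y1 * k1 (x1, y1))%:E.

Definition hardy_steklov2 (R : realType) (a2 b2 : R * R -> R)
    (k2 : R * R * R -> R) (x1 : R) (g : R -> R) (x2 : R) : \bar R :=
  \int[lebesgue_measure]_(y2 in `[a2 (x1, x2), b2 (x1, x2)])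
    (g y2 * k2 (x1, x2, y2))%:E.

Definition hardy_steklov (R : realType) (a1 b1 : R -> R) (a2 b2 : R * R -> R)
    (k1 : R * R -> R) (k2 : R * R * R -> R)
    (f : R * R -> R) (x : R * R) : \bar R :=
  \int[lebesgue_measure]_(y1 in `[a1 x.1, b1 x.1])
    \int[lebesgue_measure]_(y2 in `[a2 x, b2 x])
      (f (y1, y2) * k1 (x.1, y1) * k2 (x.1, x.2, y2))%:E.

(* Main.v *)
Require Import Defs.
From HB Require Import structures.
From mathcomp Require Import all_boot all_order all_algebra.
From mathcomp Require Import all_classical all_reals all_analysis.
From mathcomp Require Import measurable_realfun.
From mathcomp Require Import ring lra.

(** For fixed [x1], Minkowski's integral inequality bounds the norm in [x2] of
    [K f (x1, .)] by the integral over [y1] of [k1 (x1, y1)] times the norm of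
    [K2 (f (y1, .))], hence by a constant times [K1 N x1], where [N y1] is the
    norm of [f (y1, .)]; boundedness of [K1] then concludes.  Since [N] may be
    infinite, on a [nu1]-null set that need not be Lebesgue-null, [K1] has to be
    extended to functions with values in the extended reals.  The variable
    limits of integration are absorbed into the kernels as indicators. *)

Set Implicit Arguments.
Unset Strict Implicit.
Unset Printing Implicit Defensive.

Import Order.TTheory GRing.Theory Num.Theory.
Import numFieldNormedType.Exports.

Local Open Scope classical_set_scope.
Local Open Scope ring_scope.
Local Open Scope ereal_scope.

(** * A weighted Jensen inequality for powers *)

(** Young's inequality for [t] and [1] with the conjugate exponents [p] and [p / (p - 1)]. The case
    [p = 1] is treated apart, its conjugate exponent being infinite. *)
Lemma powR_bernoulli (R : realType) (p t : R) : (1 <= p)%R -> (0 <= t)%R ->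
  (p * t <= t `^ p + (p - 1))%R.
Proof.
rewrite le_eqVlt => /predU1P[<-|p1] t0.
  by rewrite powRr1// mul1r subrr addr0.
have p0 : (0 < p)%R by rewrite (lt_trans ltr01).
have pB1 : (0 < p - 1)%R by rewrite subr_gt0.
have := @conjugate_powR _ t 1%R p (p / (p - 1))%R t0 ler01 p0.
rewrite divr_gt0// => /(_ isT); rewrite invf_div mulr1 powR1.
have -> : (p^-1 + (p - 1) / p = 1)%R by field; rewrite gt_eqF.
move=> /(_ erefl); move: (t `^ p)%R => u H.
have -> : (u + (p - 1) = p * (u / p + 1 * ((p - 1) / p)))%R.
  by field; rewrite gt_eqF.
by rewrite ler_pM2l.
Qed.

Lemma ge0_le_poweR (R : realType) (r : R) (x y : \bar R) :
  (0 <= r)%R -> 0 <= x -> x <= y -> x `^ r <= y `^ r.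
Proof.
move=> r0 x0 xy; apply: gt0_ler_poweR => //; rewrite in_itv/= leey andbT//.
exact: le_trans xy.
Qed.

(** Bernoulli's inequality at [t = f / (n * s)], multiplied by [n]. The left side is linear in [f],
    so integrating with [s] fixed bounds the integral of [f]. If [n = 0], then [f = 0] makes both
    sides vanish, whatever value the power of [0] takes. *)
Lemma weighted_bernoulli (R : realType) (p s n : R) (f : \bar R) :
  (1 <= p)%R -> (0 < s)%R -> (0 <= n)%R -> 0 <= f -> (n = 0%R -> f = 0) ->
  (p / s)%:E * f <=
  (s `^ (- p))%:E * (f `^ p * (n `^ (1 - p))%:E) + ((p - 1) * n)%:E.
Proof.
move=> p1 s0 n0 f0 nf.
have p0 : (0 < p)%R by rewrite (lt_le_trans ltr01).
move: n0; rewrite le_eqVlt => /predU1P[n0|n0].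
  rewrite nf// poweR0r ?gt_eqF// mul0e !mule0 add0e lee_fin.
  by rewrite -n0 mulr0.
case: f f0 nf => // [f f0 _|_ _]; last first.
  rewrite poweRyr ?gt_eqF// gt0_mulye ?lte_fin ?powR_gt0//.
  rewrite gt0_muley ?lte_fin ?divr_gt0// gt0_muley ?lte_fin ?powR_gt0//.
rewrite lee_fin in f0; rewrite poweR_EFin -!EFinM -EFinD lee_fin.
have t0 : (0 <= f / (n * s))%R by rewrite divr_ge0// mulr_ge0// ltW.
have -> : (p / s * f = p * (f / (n * s)) * n)%R by field; rewrite !gt_eqF.
apply: (@le_trans _ _ (((f / (n * s)) `^ p + (p - 1)) * n)%R).
  by rewrite ler_pM2r// powR_bernoulli.
rewrite mulrDl lerD2r le_eqVlt; apply/orP; left; apply/eqP.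
have -> : (f / (n * s) = f * n `^ (- 1) * s `^ (- 1))%R.
  by rewrite !powR_inv1 ?ltW//; field; rewrite !gt_eqF.
rewrite !powRM ?mulr_ge0 ?powR_ge0// -!powRrM !mulN1r.
by rewrite powRD ?(gt_eqF n0) ?implybT// powRr1 ?ltW//; ring.
Qed.

(** For the measure with density [n], of mass at most [a], this is Jensen's inequality applied to
    [f / n]. It follows by integrating [weighted_bernoulli] and optimising the free parameter [s],
    without normalising the mass to 1. *)
Lemma jensen_weighted d (T : measurableType d) (R : realType)
    (lam : {measure set T -> \bar R}) (f : T -> \bar R) (n : T -> R) (p a : R) :
  (1 <= p)%R -> (0 < a)%R -> measurable_fun setT f -> measurable_fun setT n ->
  (forall y, 0 <= f y) -> (forall y, 0 <= n y)%R ->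
  (forall y, n y = 0%R -> f y = 0) ->
  \int[lam]_y (n y)%:E <= a%:E ->
  (\int[lam]_y f y) `^ p <=
  (a `^ (p - 1))%:E * \int[lam]_y (f y `^ p * (n y `^ (1 - p))%:E).
Proof.
move=> p1 a0 mf mn f0 n0 nf nA.
have p0 : (0 < p)%R by rewrite (lt_le_trans ltr01).
set g := fun y => f y `^ p * (n y `^ (1 - p))%:E.
have mg : measurable_fun setT g.
  apply: emeasurable_funM; first exact: (measurableT_comp (measurable_poweR _)).
  by apply/measurable_EFinP; exact: (measurableT_comp (measurable_powR _)).
have g0 y : 0 <= g y by rewrite mule_ge0 ?poweR_ge0// lee_fin powR_ge0.
set G := \int[lam]_y g y; set H := \int[lam]_y f y.
have G0 : 0 <= G by exact: integral_ge0.
have H0 : 0 <= H by exact: integral_ge0.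
have key (s : R) : (0 < s)%R ->
    (p / s)%:E * H <= (s `^ (- p))%:E * G + ((p - 1) * a)%:E.
  move=> s0.
  have ps0 : (0 <= p / s)%R by rewrite divr_ge0 ?ltW.
  rewrite -ge0_integralZl//.
  apply: (@le_trans _ _ (\int[lam]_y
      ((s `^ (- p))%:E * g y + ((p - 1) * n y)%:E))).
    apply: ge0_le_integral => //.
    - by move=> y _; rewrite mule_ge0.
    - exact: measurable_funeM.
    - apply: emeasurable_funD; first exact: measurable_funeM.
      by apply/measurable_EFinP; exact: measurable_funM.
    - by move=> y _; apply: weighted_bernoulli => //; exact: nf.
  rewrite ge0_integralD//.
  - rewrite ge0_integralZl ?lee_fin ?powR_ge0// leeD2l//.
    under eq_integral do rewrite EFinM.
    rewrite ge0_integralZl ?lee_fin ?subr_ge0//.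
    + by rewrite EFinM; apply: lee_wpmul2l => //; rewrite lee_fin subr_ge0.
    + exact/measurable_EFinP.
    + by move=> y _; rewrite lee_fin.
  - by move=> y _; rewrite mule_ge0// lee_fin powR_ge0.
  - exact: measurable_funeM.
  - by move=> y _; rewrite lee_fin mulr_ge0 ?subr_ge0.
  - by apply/measurable_EFinP; exact: measurable_funM.
(* [s = 1] shows that [H] is finite; the optimal parameter is [s = H / a]. *)
case: (eqVneq G +oo) => [->|Goo].
  by rewrite gt0_muley ?leey// lte_fin powR_gt0.
have Gfin : G \is a fin_num by rewrite ge0_fin_numE// ltey.
have Hfin : H \is a fin_num.
  rewrite ge0_fin_numE// ltNge leye_eq; apply/negP => /eqP Hoo.
  have := key 1%R ltr01; rewrite Hoo gt0_muley ?lte_fin ?divr_gt0//.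
  by rewrite -(fineK Gfin) -EFinM -EFinD leye_eq.
move: key H0 G0; rewrite -(fineK Gfin) -(fineK Hfin) poweR_EFin !lee_fin.
move: (fine G) (fine H) => {Gfin Hfin Goo}u {}h key.
rewrite le_eqVlt => /predU1P[<- u0|h0 u0].
  by rewrite powR0 ?gt_eqF// mulr_ge0// powR_ge0.
have s0 : (0 < h / a)%R by rewrite divr_gt0.
have := key _ s0; rewrite lee_fin.
(* For [s = h / a] the left side is [p * a]; subtracting [(p - 1) * a] leaves [a] bounded by [u]
   over the [p]-th power of [s]. *)
have -> : (p / (h / a) * h = p * a)%R by field; rewrite !gt_eqF.
rewrite powRN => K.
have {K} : (a <= ((h / a) `^ p)^-1 * u)%R by lra.
rewrite mulrC ler_pdivlMr ?powR_gt0// powRM ?invr_ge0 ?(ltW a0) ?(ltW h0)//.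
rewrite -powR_inv1 ?(ltW a0)// -powRrM mulN1r mulrCA => K.
(* The inserted powers of [a] have exponents [p - 1], [1] and [- p], so their product is 1. *)
have -> : (h `^ p = a `^ (p - 1) * (h `^ p * (a * a `^ (- p))))%R.
  rewrite -{2}(powRr1 (ltW a0)) -powRD ?(gt_eqF a0) ?implybT// mulrCA.
  rewrite -powRD ?(gt_eqF a0) ?implybT//.
  by rewrite (_ : _ + _ = 0)%R ?powRr0 ?mulr1//; ring.
by rewrite ler_wpM2l ?powR_ge0.
Qed.

(** * Nonnegative integrals and almost everywhere statements *)

Lemma ge0_integral0_ae d (T : measurableType d) (R : realType)
    (mu : {measure set T -> \bar R}) (f : T -> \bar R) :
  measurable_fun setT f -> (forall x, 0 <= f x) -> \int[mu]_x f x = 0 ->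
  {ae mu, forall x, f x = 0}.
Proof.
move=> mf f0 If; have := (ae_eq_integral_abs mu measurableT mf).1.
under eq_integral do rewrite gee0_abs//.
by move=> /(_ If); apply: filterS => x /(_ I).
Qed.

Lemma ae0_ge0_integral0 d (T : measurableType d) (R : realType)
    (mu : {measure set T -> \bar R}) (f : T -> \bar R) :
  measurable_fun setT f -> (forall x, 0 <= f x) ->
  {ae mu, forall x, f x = 0} -> \int[mu]_x f x = 0.
Proof.
move=> mf f0 fae; rewrite (ae_eq_integral (cst 0))//.
- by rewrite integral0.
- by apply: filterS fae => x + _.
Qed.

Lemma ge0_integral_lty_ae d (T : measurableType d) (R : realType)
    (mu : {measure set T -> \bar R}) (f : T -> \bar R) :
  measurable_fun setT f -> (forall x, 0 <= f x) -> \int[mu]_x f x < +oo ->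
  {ae mu, forall x, f x < +oo}.
Proof.
move=> mf f0 foo.
have : mu.-integrable setT f.
  by apply/integrableP; split => //; under eq_integral do rewrite gee0_abs//.
move=> /integrable_ae => /(_ measurableT); apply: filterS => x /(_ I).
by rewrite ge0_fin_numE.
Qed.

Lemma emeasurable_fun_poweR d (T : measurableType d) (R : realType)
    (f : T -> \bar R) (r : R) :
  measurable_fun setT f -> measurable_fun setT (fun x => f x `^ r).
Proof. by move=> mf; exact: (measurableT_comp (measurable_poweR r)). Qed.

(** * Minkowski's integral inequality *)

Section minkowski_integral.
Context d1 d2 (T1 : measurableType d1) (T2 : measurableType d2) (R : realType).
Variables (mu : {sigma_finite_measure set T1 -> \bar R}).
Variables (lam : {sigma_finite_measure set T2 -> \bar R}).

Lemma emeasurable_fubini_tonelli_F (F : T1 * T2 -> \bar R) :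
  measurable_fun setT F -> (forall z, 0 <= F z) ->
  measurable_fun setT (fun x => \int[lam]_y F (x, y)).
Proof. by move=> mF F0; exact: (measurable_fun_fubini_tonelli_F F). Qed.

(** Needed for operators applied to signed functions, where nothing is assumed integrable: the
    difference of the two Tonelli parts is measurable even where it is [+oo - oo]. *)
Lemma emeasurable_fubini_F (F : T1 * T2 -> \bar R) :
  measurable_fun setT F -> measurable_fun setT (fun x => \int[lam]_y F (x, y)).
Proof.
move=> mF.
rewrite (_ : (fun x => _) =
    (fun x => \int[lam]_y F^\+ (x, y) - \int[lam]_y F^\- (x, y))).
  apply: emeasurable_funB; apply: emeasurable_fubini_tonelli_F => //.
  - exact: measurable_funepos.
  - exact: measurable_funeneg.
apply/funext => x; rewrite integralE; congr (_ - _); apply: eq_integral => y _.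
- by rewrite !funeposE.
- by rewrite !funenegE.
Qed.

(* Jensen's inequality with weight [N y], the norm of [F (., y)], where
   [0 < N y < +oo]; the remaining [y] do not contribute for almost every [x]. *)
Lemma minkowski_integral (F : T1 * T2 -> \bar R) (p : R) :
  (1 <= p)%R -> measurable_fun setT F -> (forall z, 0 <= F z) ->
  (\int[mu]_x (\int[lam]_y F (x, y)) `^ p) `^ p^-1 <=
  \int[lam]_y (\int[mu]_x F (x, y) `^ p) `^ p^-1.
Proof.
move=> p1 mF F0.
have p0 : (0 < p)%R by rewrite (lt_le_trans ltr01).
have pV0 : (0 < p^-1)%R by rewrite invr_gt0.
have mFp := emeasurable_fun_poweR p mF.
set N := fun y => (\int[mu]_x F (x, y) `^ p) `^ p^-1.
have mN : measurable_fun setT N.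
  apply: emeasurable_fun_poweR.
  apply: (measurable_fun_fubini_tonelli_G (fun z => F z `^ p)) => // z.
  exact: poweR_ge0.
have N0 y : 0 <= N y by exact: poweR_ge0.
have Np y : N y `^ p = \int[mu]_x F (x, y) `^ p.
  rewrite /N -poweRrM mulVf ?gt_eqF// poweRe1// integral_ge0//.
  by move=> x _; exact: poweR_ge0.
set A := \int[lam]_y N y.
have A0 : 0 <= A by exact: integral_ge0.
have [->|Aoo] := eqVneq A +oo; first by rewrite leey.
have Afin : A \is a fin_num by rewrite ge0_fin_numE// ltey.
(* [A] may be 0, whereas [jensen_weighted] asks for a positive bound on the mass; hence
   [a = A + e]. *)
apply/lee_addgt0Pr => e e0.
set a := (fine A + e)%R.
have a0 : (0 < a)%R by rewrite ltr_wpDl// fine_ge0.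
have -> : A + e%:E = a%:E by rewrite EFinD fineK.
pose D := N @^-1` `](0 : \bar R), (+oo)%E[.
have mD : measurable D.
  by rewrite -[D]setTI; apply: mN => //; exact: emeasurable_itv.

have NE y : N y < +oo -> ~ D y -> N y = 0.
  move=> Noo nD; apply/eqP; rewrite eq_le N0 andbT leNgt; apply/negP => Ny.
  by apply: nD; rewrite /D/= in_itv/= Ny.
have m1D (B : set T2) : measurable B ->
    measurable_fun setT (fun z : T1 * T2 => F z * (\1_B z.2)%:E).
  move=> mB; apply: emeasurable_funM => //; apply/measurable_EFinP.
  by apply: measurableT_comp => //; exact: measurable_indic.
have F1D (B : set T2) z : 0 <= F z * (\1_B z.2)%:E.
  by rewrite mule_ge0// lee_fin.
have mFc := m1D _ (measurableC mD).
(* By Tonelli it is enough to integrate in [x] first. As [A] is finite, almost every [y] outside [D]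
   has [N y = 0], so [F (x, y)] vanishes for almost every [x]. *)
have Fc0 : {ae mu, forall x, \int[lam]_y (F (x, y) * (\1_(~` D) y)%:E) = 0}.
  apply: ge0_integral0_ae.
  - apply: (emeasurable_fubini_tonelli_F
      (F := fun z => F z * (\1_(~` D) z.2)%:E)) => //.
  - by move=> x; apply: integral_ge0 => y _; exact: (F1D _ (x, y)).
  rewrite (fubini_tonelli (fun z => F z * (\1_(~` D) z.2)%:E))//=.
  apply: ae0_ge0_integral0.
  - apply: (measurable_fun_fubini_tonelli_G
      (fun z => F z * (\1_(~` D) z.2)%:E)) => //.
  - by move=> y; apply: integral_ge0 => x _; exact: (F1D _ (x, y)).
  have : {ae lam, forall y, N y < +oo}.
    by apply: ge0_integral_lty_ae => //; rewrite -/A ltey.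
  apply: filterS => y Noo; have [Dy|nDy] := pselect (D y).
    rewrite integral0_eq// => x _; rewrite indicE memNset ?mule0//=.
  apply: ae0_ge0_integral0.
  - exact: (measurableT_comp (m1D _ (measurableC mD)) (pair2_measurable y)).
  - by move=> x; exact: (F1D _ (x, y)).
  have : {ae mu, forall x, F (x, y) `^ p = 0}.
    apply: ge0_integral0_ae.
    + by apply: emeasurable_fun_poweR; exact: measurableT_comp.
    + by move=> x; exact: poweR_ge0.
    by rewrite -Np NE// poweR0r ?gt_eqF.
  by apply: filterS => x /poweR_eq0_eq0 ->//; rewrite mul0e.
pose Fd z := F z * (\1_D z.2)%:E.
have mFd : measurable_fun setT Fd by exact: m1D.
have Fd0 z : 0 <= Fd z by exact: F1D.
have HFd : {ae mu, forall x, \int[lam]_y F (x, y) = \int[lam]_y Fd (x, y)}.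
  apply: filterS Fc0 => x Fcx.
  rewrite -[RHS]adde0 -Fcx -ge0_integralD//.
  - apply: eq_integral => y _; rewrite /Fd/= !indicE in_setC.
    by case: (y \in D); rewrite !(mule0, mule1, add0e, adde0).
  - exact: measurableT_comp.
  - exact: (measurableT_comp (m1D _ (measurableC mD)) (pair1_measurable x)).
(* Since [fine] sends [+oo] to 0, the real weight [n] vanishes exactly outside [D], where [Fd]
   vanishes too, as [jensen_weighted] requires. *)
pose n y := fine (N y).
have mn : measurable_fun setT n.
  by exact: measurableT_comp (fine_measurable _) mN.
have n0 y : (0 <= n y)%R by exact: fine_ge0.
have mFdp := emeasurable_fun_poweR p mFd.
have mW : measurable_fun setT
    (fun z : T1 * T2 => Fd z `^ p * (n z.2 `^ (1 - p))%:E).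
  apply: emeasurable_funM => //; apply/measurable_EFinP.
  by apply: measurableT_comp (measurable_powR _) _; exact: measurableT_comp.
have W0 (z : T1 * T2) : 0 <= Fd z `^ p * (n z.2 `^ (1 - p))%:E.
  by rewrite mule_ge0 ?poweR_ge0// lee_fin powR_ge0.
(* Writing [a] as a power with exponent [p^-1] allows the outer root to be dropped on both sides. *)
have apow : a = ((a `^ p) `^ p^-1)%R.
  by rewrite -powRrM mulfV ?gt_eqF// powRr1 ?ltW.
rewrite apow -poweR_EFin; apply: ge0_le_poweR; first exact: ltW.
  by apply: integral_ge0 => x _; exact: poweR_ge0.
have mH : measurable_fun setT (fun x => (\int[lam]_y F (x, y)) `^ p).
  by apply: emeasurable_fun_poweR; exact: emeasurable_fubini_tonelli_F.
have mHd : measurable_fun setT (fun x => (\int[lam]_y Fd (x, y)) `^ p).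
  by apply: emeasurable_fun_poweR; exact: emeasurable_fubini_tonelli_F.
have mHw := emeasurable_fubini_tonelli_F mW W0.
have nA : \int[lam]_y (n y)%:E <= A.
  apply: ge0_le_integral => //.
  - by move=> y _; rewrite lee_fin.
  - exact/measurable_EFinP.
  - move=> y _; rewrite /n; have := N0 y.
    by case: (N y) => //= _; rewrite leey.
rewrite (ae_eq_integral (fun x => (\int[lam]_y Fd (x, y)) `^ p))//; last first.
  by apply: filterS HFd => x -> _.
(* Jensen's inequality in [y] for each fixed [x]. *)
apply: (@le_trans _ _ (\int[mu]_x ((a `^ (p - 1))%:E *
    \int[lam]_y (Fd (x, y) `^ p * (n y `^ (1 - p))%:E)))).
  apply: ge0_le_integral => //.
  - by move=> x _; exact: poweR_ge0.
  - exact: measurable_funeM.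
  move=> x _; apply: jensen_weighted => //.
  - exact: measurableT_comp.
  - move=> y ny0; rewrite /Fd/= indicE memNset ?mule0//.
    rewrite /D/= in_itv/= => /andP[Ny Noo].
    have Nfin : N y \is a fin_num by rewrite ge0_fin_numE.
    by move: Ny; rewrite -(fineK Nfin) -/(n y) ny0 lte_fin ltxx.
  - by rewrite (le_trans nA)// -(fineK Afin) lee_fin lerDl ltW.
rewrite ge0_integralZl//; last 2 first.
- by move=> x _; apply: integral_ge0 => y _; exact: (W0 (x, y)).
- by rewrite lee_fin powR_ge0.
(* After the exchange, the integral of the [p]-th power of [Fd] in [x] is that power of [N y] on
   [D]. Multiplied by the weight with exponent [1 - p] it gives back [N y], whose integral is
   [A <= a]. *)
rewrite (fubini_tonelli (fun z => Fd z `^ p * (n z.2 `^ (1 - p))%:E))//=.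
have -> : ((a `^ p)%:E = (a `^ (p - 1))%:E * a%:E).
  by rewrite -EFinM -{3}(powRr1 (ltW a0)) -powRD ?subrK ?(gt_eqF a0) ?implybT.
apply: lee_wpmul2l; first by rewrite lee_fin powR_ge0.
apply: (@le_trans _ _ A); last by rewrite -(fineK Afin) lee_fin lerDl ltW.
apply: le_trans nA; apply: ge0_le_integral => //.
- by move=> y _; apply: integral_ge0 => x _; exact: (W0 (x, y)).
- exact: (measurable_fun_fubini_tonelli_G
    (fun z => Fd z `^ p * (n z.2 `^ (1 - p))%:E)).
- exact/measurable_EFinP.
move=> y _; rewrite ge0_integralZr//; last 3 first.
- exact: (measurableT_comp mFdp).
- by move=> x _; exact: poweR_ge0.
- by rewrite lee_fin powR_ge0.
have [Dy|nDy] := pselect (D y); last first.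
  rewrite integral0_eq ?mul0e ?lee_fin// => x _.
  by rewrite /Fd/= indicE memNset// mule0 poweR0r ?gt_eqF.
under eq_integral do rewrite /Fd/= indicE mem_set// mule1.
rewrite -Np; move: Dy; rewrite /D /n/= in_itv/=.
case: (N y) => [r||]; rewrite ?ltxx ?andbF// lte_fin => /andP[r0 _] /=.
rewrite -EFinM -powRD ?(gt_eqF r0) ?implybT//.
by rewrite addrC subrK powRr1// ltW.
Qed.

End minkowski_integral.

(** * Monotonicity, homogeneity, finiteness and measurability of Lebesgue norms *)

Section Lnorm_lemmas.
Context d (T : measurableType d) (R : realType).
Variable mu : {measure set T -> \bar R}.
Implicit Types (f g : T -> \bar R) (p : R).

Lemma ae_le_Lnorm f g p : (0 < p)%R ->
  measurable_fun setT f -> measurable_fun setT g ->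
  {ae mu, forall x, `|f x| <= `|g x|} ->
  Lnorm mu p%:E f <= Lnorm mu p%:E g.
Proof.
move=> p0 mf mg fg; rewrite unlock; apply: ge0_le_poweR.
- by rewrite invr_ge0 ltW.
- by apply: integral_ge0 => x _; exact: poweR_ge0.
apply: ae_ge0_le_integral => //.
- by move=> x _; exact: poweR_ge0.
- by apply: emeasurable_fun_poweR; exact: measurableT_comp.
- by move=> x _; exact: poweR_ge0.
- by apply: emeasurable_fun_poweR; exact: measurableT_comp.
- by apply: filterS fg => x fgx _; apply: ge0_le_poweR => //; exact: ltW.
Qed.

Lemma ge0_LnormZ f p (c : R) :
  (0 < p)%R -> (0 <= c)%R -> measurable_fun setT f ->
  Lnorm mu p%:E (fun x => c%:E * f x) = c%:E * Lnorm mu p%:E f.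
Proof.
move=> p0 c0 mf; rewrite unlock.
under eq_integral do rewrite abseM poweRM//.
rewrite ge0_integralZl//.
- rewrite poweRM ?poweR_ge0//.
    rewrite -poweRrM mulfV ?gt_eqF// poweRe1 ?abse_ge0//.
    by rewrite gee0_abs.
  by apply: integral_ge0 => x _; exact: poweR_ge0.
- by apply: emeasurable_fun_poweR; exact: measurableT_comp.
- by move=> x _; exact: poweR_ge0.
- exact: poweR_ge0.
Qed.

Lemma Lnorm_lty_ae f p : (0 < p)%R -> measurable_fun setT f ->
  Lnorm mu p%:E f < +oo -> {ae mu, forall x, `|f x| < +oo}.
Proof.
move=> p0 mf; rewrite unlock => /lty_poweRy.
rewrite invr_eq0 gt_eqF// => /(_ isT).
move=> /ge0_integral_lty_ae; case.
- by apply: emeasurable_fun_poweR; exact: measurableT_comp.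
- by move=> x; exact: poweR_ge0.
move=> B [mB B0 sB]; exists B; split => //; apply: subset_trans sB => x /= H H'.
by apply: H; apply: lty_poweRy H'; rewrite gt_eqF.
Qed.

End Lnorm_lemmas.

Lemma measurable_Lnorm_section d1 d2 (T1 : measurableType d1)
    (T2 : measurableType d2) (R : realType)
    (mu : {sigma_finite_measure set T2 -> \bar R}) (p : R)
    (F : T1 * T2 -> \bar R) :
  measurable_fun setT F ->
  measurable_fun setT (fun x => Lnorm mu p%:E (fun y => F (x, y))).
Proof.
move=> mF; rewrite unlock; apply: emeasurable_fun_poweR.
apply: (@emeasurable_fubini_tonelli_F _ _ _ _ _ mu (fun z => `|F z| `^ p)).
- by apply: emeasurable_fun_poweR; exact: measurableT_comp.
- by move=> z; exact: poweR_ge0.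
Qed.

(** * One-variable integral operators on extended-real functions *)

(** The constant in [bounded_by] carries no sign; this allows it to be enlarged to a nonnegative or
    positive one. *)
Lemma bounded_byW (R : realType) d (X : measurableType d) (C C' : R)
    (normS normT : (X -> \bar R) -> \bar R) (K : (X -> R) -> (X -> \bar R)) :
  (forall f, 0 <= normS f) -> (C <= C')%R ->
  bounded_by C normS normT K -> bounded_by C' normS normT K.
Proof.
move=> n0 CC' bK f mf fS; have [mK Kf] := bK f mf fS; split => //.
by apply: (le_trans Kf); apply: lee_wpmul2r.
Qed.

Definition integral_operator d (T : measurableType d) (R : realType)
    (lam : {measure set T -> \bar R}) (k : T * T -> R)
    (g : T -> R) (x : T) : \bar R :=
  \int[lam]_y (g y * k (x, y))%:E.

(* Applied to the indicator of the null set [N = +oo], boundedness shows that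
   for almost every [x] the kernel vanishes almost everywhere on that set. *)
Lemma integral_operator_bounded_ereal d (T : measurableType d) (R : realType)
    (mu nu : {measure set T -> \bar R})
    (lam : {sigma_finite_measure set T -> \bar R})
    (k : T * T -> R) (p q C : R) (N : T -> \bar R) :
  (0 < p)%R -> (0 < q)%R -> (0 <= C)%R ->
  measurable_fun setT k -> (forall z, 0 <= k z)%R ->
  bounded_by C (Lnorm nu q%:E) (Lnorm mu p%:E) (integral_operator lam k) ->
  measurable_fun setT N -> (forall y, 0 <= N y) -> Lnorm nu q%:E N < +oo ->
  Lnorm mu p%:E (fun x => \int[lam]_y (N y * (k (x, y))%:E)) <=
  C%:E * Lnorm nu q%:E N.
Proof.
move=> p0 q0 C0 mk k0 bK mN N0 Noo.
pose B := N @^-1` [set +oo].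
have mB : measurable B by rewrite -[B]setTI; exact: mN.
have Nae : {ae nu, forall y, N y < +oo}.
  by have := Lnorm_lty_ae q0 mN Noo; apply: filterS => y; rewrite gee0_abs.
have m1B : measurable_fun setT (\1_B : T -> R) by exact: measurable_indic.
have nu1B : Lnorm nu q%:E (EFin \o \1_B) = 0.
  apply/eqP; rewrite eq_le Lnorm_ge0 andbT -(@Lnorm0 _ _ _ nu q%:E).
    apply: ae_le_Lnorm => //; first exact/measurable_EFinP.
    apply: filterS Nae => y Ny; rewrite /= indicE memNset ?normr0//.
    by move=> /= Ey; rewrite Ey in Ny.
  by rewrite eqe gt_eqF.
have [|mK1B] := bK _ m1B; first by rewrite nu1B.
rewrite nu1B mule0 => K1B.
have {K1B} : Lnorm mu p%:E (integral_operator lam k \1_B) = 0.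
  by apply/eqP; rewrite eq_le K1B Lnorm_ge0.
move=> /(Lnorm_eq0_eq0 mK1B); rewrite lte_fin => /(_ p0) K1B.
(* [fine \o N] is a real-valued function equal to [N] off [B] and to 0 on [B], so the boundedness
   hypothesis applies to it. *)
have mg : measurable_fun setT (fine \o N).
  by exact: measurableT_comp (fine_measurable _) mN.
have gN y : `|(fine (N y))%:E| <= `|N y|.
  rewrite gee0_abs ?lee_fin ?fine_ge0//; have := N0 y.
  by case: (N y) => //= r r0; rewrite lee_fin ler_norm.
have gS : Lnorm nu q%:E (EFin \o (fine \o N)) <= Lnorm nu q%:E N.
  apply: ae_le_Lnorm => //; first exact/measurable_EFinP.
  exact: nearW.
have [|mKg Kg] := bK _ mg; first exact: le_lt_trans gS Noo.
have mNk : measurable_fun setT (fun z : T * T => N z.2 * (k z)%:E).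
  apply: emeasurable_funM; first exact: measurableT_comp.
  exact/measurable_EFinP.
apply: (@le_trans _ _
    (Lnorm mu p%:E (integral_operator lam k (fine \o N)))); last first.
  by apply: (le_trans Kg); apply: lee_wpmul2l.
apply: ae_le_Lnorm => //.
  exact: (@emeasurable_fubini_F _ _ _ _ _ lam (fun z => N z.2 * (k z)%:E)).
apply: filterS K1B => x /(_ I) Kx.
(* The integrands differ at most on [B], where for this [x] the kernel is 0 almost everywhere and
   [+oo * 0 = 0]. *)
suff -> : \int[lam]_y (N y * (k (x, y))%:E) =
  integral_operator lam k (fine \o N) x by [].
apply: ae_eq_integral => //.
- exact: (measurableT_comp mNk (pair1_measurable x)).
- apply/measurable_EFinP; apply: measurable_funM => //.
  exact: (measurableT_comp mk (pair1_measurable x)).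
have : {ae lam, forall y, (\1_B y * k (x, y))%:E = 0}.
  apply: ge0_integral0_ae => //.
  - apply/measurable_EFinP; apply: measurable_funM => //.
    exact: (measurableT_comp mk (pair1_measurable x)).
  - by move=> y; rewrite lee_fin mulr_ge0.
apply: filterS => y /eqP; rewrite eqe mulf_eq0 => /orP[|/eqP ky0 _]; last first.
  by rewrite ky0 mule0 mulr0.
rewrite indicE; have [yB|yB] := boolP (y \in B); first by rewrite oner_eq0.
move=> _ _; rewrite EFinM /= fineK// ge0_fin_numE// ltey.
by move: yB; apply: contraNneq => Ny; rewrite inE.
Qed.

(** * Iterated operators with product kernels between mixed norm spaces *)

Section iterated_operator.
Context d1 d2 (T1 : measurableType d1) (T2 : measurableType d2) (R : realType).
Variables (lam1 : {sigma_finite_measure set T1 -> \bar R}).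
Variables (lam2 : {sigma_finite_measure set T2 -> \bar R}).
Variables (mu1 nu1 : {sigma_finite_measure set T1 -> \bar R}).
Variables (mu2 nu2 : {sigma_finite_measure set T2 -> \bar R}).

Definition iterated_operator (k1 : T1 * T1 -> R) (k2 : T1 * T2 * T2 -> R)
    (f : T1 * T2 -> R) (x : T1 * T2) : \bar R :=
  \int[lam1]_y1 \int[lam2]_y2
    (f (y1, y2) * k1 (x.1, y1) * k2 (x.1, x.2, y2))%:E.

(** The mixed norm as a norm of norms, so that the facts on [Lnorm] apply in each variable
    separately. *)
Definition iterated_Lnorm (m1 : {measure set T1 -> \bar R})
    (m2 : {measure set T2 -> \bar R}) (p1 p2 : R) (f : T1 * T2 -> \bar R) :=
  Lnorm m1 p1%:E (fun x1 => Lnorm m2 p2%:E (fun x2 => f (x1, x2))).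

Variables (k1 : T1 * T1 -> R) (k2 : T1 * T2 * T2 -> R).
Hypotheses (mk1 : measurable_fun setT k1) (mk2 : measurable_fun setT k2).
Hypotheses (k10 : forall z, (0 <= k1 z)%R) (k20 : forall z, (0 <= k2 z)%R).

(** The inner integral as a function of [x1], [x2] and [y1] jointly, since Tonelli and Minkowski
    need joint measurability. *)
Let inner f (z : T1 * T2 * T1) : \bar R :=
  \int[lam2]_y2 (f (z.2, y2) * k1 (z.1.1, z.2) * k2 (z.1.1, z.1.2, y2))%:E.

Let measurable_inner f : measurable_fun setT f -> measurable_fun setT (inner f).
Proof.
move=> mf; apply: (@emeasurable_fubini_F _ _ _ _ _ lam2
  (fun w : T1 * T2 * T1 * T2 =>
    (f (w.1.2, w.2) * k1 (w.1.1.1, w.1.2) * k2 (w.1.1.1, w.1.1.2, w.2))%:E)).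
have m11 : measurable_fun setT (fun w : T1 * T2 * T1 * T2 => w.1.1).
  exact: measurableT_comp.
have m111 : measurable_fun setT (fun w : T1 * T2 * T1 * T2 => w.1.1.1).
  exact: measurableT_comp.
have m112 : measurable_fun setT (fun w : T1 * T2 * T1 * T2 => w.1.1.2).
  exact: measurableT_comp.
have m12 : measurable_fun setT (fun w : T1 * T2 * T1 * T2 => w.1.2).
  exact: measurableT_comp.
apply/measurable_EFinP; apply: measurable_funM; first apply: measurable_funM.
- by apply: measurableT_comp => //; exact: measurable_fun_pair.
- by apply: measurableT_comp => //; exact: measurable_fun_pair.
- apply: measurableT_comp => //; apply: measurable_fun_pair => //.
  exact: measurable_fun_pair.
Qed.

Lemma measurable_iterated_operator f : measurable_fun setT f ->
  measurable_fun setT (iterated_operator k1 k2 f).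
Proof.
move=> mf; apply: (@emeasurable_fubini_F _ _ _ _ _ lam1 (inner f)).
exact: measurable_inner.
Qed.

Let inner_ge0 f z : (forall y, 0 <= f y)%R -> 0 <= inner f z.
Proof.
by move=> f0; apply: integral_ge0 => y2 _; rewrite lee_fin !mulr_ge0.
Qed.

(** Passing to the absolute value of [f] gives a nonnegative integrand, to which Minkowski's
    inequality applies. No integrability is assumed: an undefined signed integral comes with an
    infinite integral of absolute values. *)
Lemma le_abse_iterated_operator f x : measurable_fun setT f ->
  `|iterated_operator k1 k2 f x| <= \int[lam1]_y1 inner (Num.norm \o f) (x, y1).
Proof.
move=> mf; have mI := measurable_inner mf.
have mnf : measurable_fun setT (Num.norm \o f) by exact: measurableT_comp.
have mIx (g : T1 * T2 -> R) :
    measurable_fun setT g -> measurable_fun setT (fun y1 => inner g (x, y1)).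
  move=> mg.
  exact: (measurableT_comp (measurable_inner mg) (pair1_measurable x)).
apply: (le_trans (le_abse_integral lam1 measurableT (mIx _ mf))).
apply: ge0_le_integral => //.
- by apply: measurableT_comp => //; exact: mIx.
- exact: mIx.
move=> y1 _.
have mb (g : T1 * T2 -> R) : measurable_fun setT g -> measurable_fun setT
   (fun y2 => (g (y1, y2) * k1 (x.1, y1) * k2 (x.1, x.2, y2))%:E).
  move=> mg; apply/measurable_EFinP; apply: measurable_funM.
    apply: measurable_funM => //.
    exact: (measurableT_comp mg (pair1_measurable y1)).
  exact: (measurableT_comp mk2 (pair1_measurable _)).
apply: (le_trans (le_abse_integral lam2 measurableT (mb _ mf))).
apply: ge0_le_integral => //.
- by apply: measurableT_comp => //; exact: mb.
- exact: mb.
move=> y2 _; rewrite lee_fin !normrM.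
by rewrite (ger0_norm (k10 _)) (ger0_norm (k20 _)).
Qed.

(** Minkowski's inequality moves the norm in [x2] inside the integral over [y1]. There [k1 (x1, y1)]
    is a constant, and the bound on the second operator is applied to each section of the absolute
    value of [f]. *)
Lemma Lnorm_iterated_operator_le f x1 (p2 q2 C : R) :
  (1 <= p2)%R -> (1 <= q2)%R -> (0 < C)%R -> measurable_fun setT f ->
  bounded_by C (Lnorm nu2 q2%:E) (Lnorm mu2 p2%:E)
    (integral_operator lam2 (fun z => k2 (x1, z.1, z.2))) ->
  Lnorm mu2 p2%:E (fun x2 => iterated_operator k1 k2 f (x1, x2)) <=
  C%:E * \int[lam1]_y1
    (Lnorm nu2 q2%:E (fun y2 => (f (y1, y2))%:E) * (k1 (x1, y1))%:E).
Proof.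
move=> p1 q1 C0 mf bK.
have p0 : (0 < p2)%R by rewrite (lt_le_trans ltr01).
have q0 : (0 < q2)%R by rewrite (lt_le_trans ltr01).
have mnf : measurable_fun setT (Num.norm \o f) by exact: measurableT_comp.
have nf0 y : (0 <= (Num.norm \o f) y)%R by exact: normr_ge0.
pose P (z : T2 * T1) := inner (Num.norm \o f) (x1, z.1, z.2).
have mP : measurable_fun setT P.
  apply: (measurableT_comp (measurable_inner mnf)).
  by do 2 (apply: measurable_fun_pair => //).
have P0 z : 0 <= P z by exact: inner_ge0.
have mPint : measurable_fun setT (fun x2 => \int[lam1]_y1 P (x2, y1)).
  exact: (@emeasurable_fubini_F _ _ _ _ _ lam1 P).
have mKf := measurable_iterated_operator mf.
apply: (@le_trans _ _ (Lnorm mu2 p2%:E (fun x2 => \int[lam1]_y1 P (x2, y1)))).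
  apply: ae_le_Lnorm => //.
    exact: (measurableT_comp mKf (pair1_measurable x1)).
  apply: nearW => x2; rewrite [leRHS]gee0_abs ?integral_ge0//.
  exact: le_abse_iterated_operator.
apply: (@le_trans _ _ (\int[lam1]_y1 Lnorm mu2 p2%:E (fun x2 => P (x2, y1)))).
  rewrite unlock.
  under eq_integral do rewrite gee0_abs ?integral_ge0//.
  under [X in _ <= X]eq_integral do under eq_integral do rewrite gee0_abs//.
  exact: minkowski_integral.
have mN : measurable_fun setT
    (fun y1 => Lnorm nu2 q2%:E (fun y2 => (f (y1, y2))%:E)).
  apply: (@measurable_Lnorm_section _ _ _ _ _ nu2 q2 (EFin \o f)).
  exact/measurable_EFinP.
have mk1x : measurable_fun setT (fun y1 => (k1 (x1, y1))%:E).
  apply/measurable_EFinP.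
  exact: (measurableT_comp mk1 (pair1_measurable x1)).
rewrite -ge0_integralZl//; last 3 first.
- exact: emeasurable_funM.
- by move=> y1 _; apply: mule_ge0; rewrite ?Lnorm_ge0 ?lee_fin.
- by rewrite lee_fin ltW.
apply: ge0_le_integral => //.
- by move=> y1 _; exact: Lnorm_ge0.
- apply: (@measurable_Lnorm_section _ _ _ _ _ mu2 p2 (fun z => P (z.2, z.1))).
  by apply: (measurableT_comp mP); exact: measurable_fun_pair.
- by apply: measurable_funeM; exact: emeasurable_funM.
move=> y1 _; rewrite muleA muleC.
have mfy : measurable_fun setT (fun y2 => `|f (y1, y2)|%R).
  exact: (measurableT_comp mnf (pair1_measurable y1)).
set K2f := integral_operator lam2 (fun z => k2 (x1, z.1, z.2))
  (fun y2 => `|f (y1, y2)|%R).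
(* [k1 (x1, y1)] depends on neither [x2] nor [y2], so it leaves both the inner integral and the
   norm. *)
have PE x2 : P (x2, y1) = (k1 (x1, y1))%:E * K2f x2.
  rewrite -ge0_integralZl ?lee_fin//.
  - by apply: eq_integral => y2 _; rewrite -EFinM /=; congr (_%:E); ring.
  - apply/measurable_EFinP; apply: measurable_funM => //.
    exact: (measurableT_comp mk2 (pair1_measurable (x1, x2))).
  - by move=> y2 _; rewrite lee_fin mulr_ge0.
have mK2f : measurable_fun setT K2f.
  apply: (@emeasurable_fubini_F _ _ _ _ _ lam2
    (fun z => (`|f (y1, z.2)| * k2 (x1, z.1, z.2))%:E)).
  apply/measurable_EFinP; apply: measurable_funM.
    exact: (measurableT_comp mfy).
  by apply: (measurableT_comp mk2); do 2 (apply: measurable_fun_pair => //).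
under eq_Lnorm do rewrite PE.
rewrite ge0_LnormZ//; apply: lee_wpmul2l; first by rewrite lee_fin.
have NE : Lnorm nu2 q2%:E (EFin \o (fun y2 => `|f (y1, y2)|%R)) =
    Lnorm nu2 q2%:E (fun y2 => (f (y1, y2))%:E) by rewrite -[RHS]Lnorm_abse.
(* Boundedness speaks only of sections of finite norm; for the others the right side is [+oo],
   because [C] is positive. *)
have [Noo|] := ltP (Lnorm nu2 q2%:E (fun y2 => (f (y1, y2))%:E)) +oo.
  have [|_] := bK _ mfy; first by rewrite NE.
  by rewrite NE.
by rewrite leye_eq => /eqP ->; rewrite gt0_muley ?leey ?lte_fin.
Qed.

(** Integration runs over whole spaces with arbitrary sigma-finite measures; the Hardy--Steklov
    operators are the case of Lebesgue measure with kernels cut off by the limits. *)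
Theorem iterated_operator_bounded (p1 p2 q1 q2 : R) :
  (1 <= p1)%R -> (1 <= p2)%R -> (1 <= q1)%R -> (1 <= q2)%R ->
  (exists C : R, bounded_by C (Lnorm nu1 q1%:E) (Lnorm mu1 p1%:E)
    (integral_operator lam1 k1)) ->
  (exists C : R, {ae mu1, forall x1,
    bounded_by C (Lnorm nu2 q2%:E) (Lnorm mu2 p2%:E)
      (integral_operator lam2 (fun z => k2 (x1, z.1, z.2)))}) ->
  exists C : R, bounded_by C (iterated_Lnorm nu1 nu2 q1 q2)
    (iterated_Lnorm mu1 mu2 p1 p2) (iterated_operator k1 k2).
Proof.
move=> p11 p21 q11 q21 [C1 bK1] [C2 bK2].
have p10 : (0 < p1)%R by rewrite (lt_le_trans ltr01).
have q10 : (0 < q1)%R by rewrite (lt_le_trans ltr01).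
(* [D2] is made strictly positive because sections of [f] may have infinite norm, and [0 * +oo = 0]
   would spoil the bound there. *)
pose D1 := Num.max C1 0%R; pose D2 := Num.max C2 1%R.
have D10 : (0 <= D1)%R by rewrite le_max lexx orbT.
have D20 : (0 < D2)%R by rewrite lt_max ltr01 orbT.
exists (D2 * D1)%R => f mf fS.
have mKf := measurable_iterated_operator mf; split => //.
pose N y1 := Lnorm nu2 q2%:E (fun y2 => (f (y1, y2))%:E).
have mN : measurable_fun setT N.
  apply: (@measurable_Lnorm_section _ _ _ _ _ nu2 q2 (EFin \o f)).
  exact/measurable_EFinP.
have mKN : measurable_fun setT
    (fun x1 => \int[lam1]_y1 (N y1 * (k1 (x1, y1))%:E)).
  apply: (@emeasurable_fubini_F _ _ _ _ _ lam1 (fun z => N z.2 * (k1 z)%:E)).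
  apply: emeasurable_funM; first exact: measurableT_comp.
  exact/measurable_EFinP.
apply: (@le_trans _ _ (Lnorm mu1 p1%:E
    (fun x1 => D2%:E * \int[lam1]_y1 (N y1 * (k1 (x1, y1))%:E)))).
  apply: ae_le_Lnorm => //.
  - exact: measurable_Lnorm_section.
  - exact: measurable_funeM.
  apply: filterS bK2 => x1 bKx; rewrite gee0_abs ?Lnorm_ge0// gee0_abs.
    apply: Lnorm_iterated_operator_le => //.
    by apply: bounded_byW bKx; [move=> g; exact: Lnorm_ge0|rewrite le_max lexx].
  apply: mule_ge0; first by rewrite lee_fin ltW.
  by apply: integral_ge0 => y1 _; apply: mule_ge0; rewrite ?Lnorm_ge0 ?lee_fin.
rewrite ge0_LnormZ ?(ltW D20)// EFinM -muleA.
apply: lee_wpmul2l; first by rewrite lee_fin ltW.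
(* The norm of [N] is by definition the mixed norm of [f], finite by [fS]. *)
apply: integral_operator_bounded_ereal => //; last first.
  by move=> y; exact: Lnorm_ge0.
by apply: bounded_byW bK1; [move=> g; exact: Lnorm_ge0|rewrite le_max lexx].
Qed.

End iterated_operator.

(** * Reduction of the Hardy--Steklov operators to iterated operators *)

Lemma mixed_normE (R : realType)
    (mu1 mu2 : {sigma_finite_measure set (measurableTypeR R) -> \bar R})
    (p1 p2 : R) (f : R * R -> \bar R) :
  mixed_norm mu1 mu2 p1 p2 f = iterated_Lnorm mu1 mu2 p1 p2 f.
Proof.
rewrite /mixed_norm /iterated_Lnorm unlock; congr (_ `^ _).
apply: eq_integral => x _.
by rewrite gee0_abs ?poweR_ge0// -poweRrM mulrC.
Qed.

Lemma measurable_between d (T : measurableType d) (R : realType)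
    (f g h : T -> R) :
  measurable_fun setT f -> measurable_fun setT g -> measurable_fun setT h ->
  measurable [set z | (f z <= g z <= h z)%R].
Proof.
move=> mf mg mh; rewrite (_ : [set _ | _] =
    (setT `&` [set z | (f z <= g z)%R]) `&`
    (setT `&` [set z | (g z <= h z)%R])).
  by apply: measurableI; exact: measurable_fun_le.
by rewrite !setTI; apply/seteqP; split => z /= /andP.
Qed.

Lemma integral_EFin_indic d (T : measurableType d) (R : realType)
    (mu : {measure set T -> \bar R}) (D : set T) (f : T -> R) :
  \int[mu]_(y in D) (f y)%:E = \int[mu]_y (f y * \1_D y)%:E.
Proof.
rewrite integral_mkcond; apply: eq_integral => y _.
by rewrite patchE indicE; case: ifPn => _; rewrite ?mulr1 ?mulr0.
Qed.

Theorem mainTheorem4 (R : realType) (p1 p2 q1 q2 : R)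
  (hp1 : (1 <= p1)%R) (hp2 : (1 <= p2)%R) (hq1 : (1 <= q1)%R) (hq2 : (1 <= q2)%R)
  (mu1 mu2 nu1 nu2 : {sigma_finite_measure set (measurableTypeR R) -> \bar R})
  (a1 b1 : R -> R) (a2 b2 : R * R -> R) (k1 : R * R -> R) (k2 : R * R * R -> R)
  (ma1 : measurable_fun setT a1) (mb1 : measurable_fun setT b1)
  (ma2 : measurable_fun setT a2) (mb2 : measurable_fun setT b2)
  (mk1 : measurable_fun setT k1) (mk2 : measurable_fun setT k2)
  (hab1 : forall x1, (a1 x1 <= b1 x1)%R) (hab2 : forall x, (a2 x <= b2 x)%R)
  (hk1 : forall z, (0 <= k1 z)%R) (hk2 : forall z, (0 <= k2 z)%R)
  (K1_bounded : exists C : R,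
     bounded_by C (Lnorm nu1 q1%:E) (Lnorm mu1 p1%:E) (hardy_steklov1 a1 b1 k1))
  (K2_bounded : exists C : R, {ae mu1, forall x1 : R,
     bounded_by C (Lnorm nu2 q2%:E) (Lnorm mu2 p2%:E)
       (hardy_steklov2 a2 b2 k2 x1)}) :
  exists C : R,
    bounded_by C (mixed_norm nu1 nu2 q1 q2) (mixed_norm mu1 mu2 p1 p2)
      (hardy_steklov a1 b1 a2 b2 k1 k2).
Proof.
(* The regions between the limits are taken in the product spaces, so that the truncated kernels
   [h1] and [h2] are jointly measurable. *)
pose E1 := [set z : R * R | (a1 z.1 <= z.2 <= b1 z.1)%R].
pose E2 := [set z : R * R * R | (a2 z.1 <= z.2 <= b2 z.1)%R].
have mE1 : measurable E1.
  apply: measurable_between; [exact: measurableT_comp|exact: measurable_snd|].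
  exact: measurableT_comp.
have mE2 : measurable E2.
  apply: measurable_between; [exact: measurableT_comp|exact: measurable_snd|].
  exact: measurableT_comp.
pose h1 z := (k1 z * \1_E1 z)%R.
pose h2 z := (k2 z * \1_E2 z)%R.
have mh1 : measurable_fun setT h1.
  by apply: measurable_funM => //; exact: measurable_indic.
have mh2 : measurable_fun setT h2.
  by apply: measurable_funM => //; exact: measurable_indic.
have h10 z : (0 <= h1 z)%R by rewrite mulr_ge0.
have h20 z : (0 <= h2 z)%R by rewrite mulr_ge0.
have E1E x y : (\1_`[a1 x, b1 x] y = \1_E1 (x, y) :> R)%R.
  by rewrite !indicE; congr (_%:R); congr nat_of_bool;
    apply/idP/idP; rewrite !inE/= in_itv.
have E2E x y : (\1_`[a2 x, b2 x] y = \1_E2 (x, y) :> R)%R.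
  by rewrite !indicE; congr (_%:R); congr nat_of_bool;
    apply/idP/idP; rewrite !inE/= in_itv.
have K1E : hardy_steklov1 a1 b1 k1 = integral_operator lebesgue_measure h1.
  apply/funext => g; apply/funext => x; rewrite /hardy_steklov1.
  rewrite integral_EFin_indic; apply: eq_integral => y _.
  by rewrite E1E mulrA.
have K2E x1 : hardy_steklov2 a2 b2 k2 x1 =
    integral_operator lebesgue_measure (fun z => h2 (x1, z.1, z.2)).
  apply/funext => g; apply/funext => x; rewrite /hardy_steklov2.
  rewrite integral_EFin_indic; apply: eq_integral => y _.
  by rewrite E2E mulrA.
have KE : hardy_steklov a1 b1 a2 b2 k1 k2 =
    iterated_operator lebesgue_measure lebesgue_measure h1 h2.
  apply/funext => f; apply/funext => -[x1 x2]; rewrite /hardy_steklov.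
  rewrite integral_mkcond; apply: eq_integral => y1 _ /=.
  rewrite patchE; have := E1E x1 y1; rewrite indicE /h1.
  (* When [y1] lies outside its limits, [h1] is 0 and the whole inner integral vanishes. *)
  case: ifPn => _ <-; rewrite ?mulr1 ?mulr0.
    rewrite integral_EFin_indic; apply: eq_integral => y2 _.
    by rewrite E2E mulrA.
  by rewrite integral0_eq// => y2 _; rewrite mulr0 mul0r.
rewrite KE.
have nE m1 m2 r1 r2 :
    mixed_norm m1 m2 r1 r2 = @iterated_Lnorm _ _ _ _ R m1 m2 r1 r2.
  by apply/funext => f; exact: mixed_normE.
rewrite !nE.
apply: (@iterated_operator_bounded _ _ (measurableTypeR R) (measurableTypeR R)
  R lebesgue_measure lebesgue_measure mu1 nu1 mu2 nu2 _ _ mh1 mh2) => //.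
  by rewrite -K1E.
(* The operators agree for every [x1], so the exceptional null set [B] is kept. *)
case: K2_bounded => C [B [mB B0 sB]]; exists C; exists B; split => //.
by move=> x1 nx1; apply: sB => /= bK; apply: nx1; move: bK; rewrite K2E.
Qed.
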